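(* Let $N_1$ and $N_2$ be non-isomorphic rank-$r$ paving matroids on a set $E$. For $i\in[2]$, let $\mathcal{H}_i$ be the set of hyperplanes of $N_i$ and let $L_i$ be the lattice of flats of $N_i$. Assume that there are partitions $\{A_1,\ldots,A_p\}$ of $\mathcal{H}_1-\mathcal{H}_2$ and $\{B_1,\ldots,B_p\}$ of $\mathcal{H}_2-\mathcal{H}_1$, and, for each $j\in[p]$, a bijection $\alpha_j:E\to E$ such that $X\in A_j$ if and only if $\alpha_j(X)\in B_j$. Let $M_1$ and $M_2$ be matroids with rank functions $r_1$ and $r_2$, for which there are lattice isomorphisms $\phi_i:L_i\to\mathcal{Z}(M_i)$, $i\in[2]$, such that - if $X\in L_1\cap L_2$, then $|\phi_1(X)|=|\phi_2(X)|$ and $r_1(\phi_1(X))=r_2(\phi_2(X))$, and - if $j\in[p]$ and $Y\in A_j$, then $|\phi_1(Y)|=|\phi_2(\alpha_j(Y))|$ and $r_1(\phi_1(Y))=r_2(\phi_2(\alpha_j(Y)))$, and moreover $|\phi_1(X)|=|\phi_1(\alpha_j(X))|$ and $r_1(\phi_1(X))=r_1(\phi_1(\alpha_j(X)))$ for all $X\subseteq Y$ with $|X|<r-1$. Then $\mathcal{G}(M_1)=\mathcal{G}(M_2)$.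
   Context: All matroids are finite. A paving matroid of rank $r$ is one in which every flat properly contained in a hyperplane is independent (every set of size less than $r-1$ is a flat). For a set $X\subseteq E$, $\alpha_j(X)$ denotes its image. A cyclic flat of a matroid $M$ is a flat that is a (possibly empty) union of circuits; the cyclic flats ordered by inclusion form a lattice $\mathcal{Z}(M)$. For a matroid $M$ on an $n$-element set of rank $k$ and a permutation $e_1,\ldots,e_n$ of its ground set, the rank sequence is $r_1\cdots r_n$ with $r_i=r(\{e_1,\ldots,e_i\})-r(\{e_1,\ldots,e_{i-1}\})$; the $\mathcal{G}$-invariant $\mathcal{G}(M)$ is the formal sum $\sum_\pi[\underline{r}(\pi)]$ over all permutations $\pi$, where the $[\underline r]$ are formal basis symbols indexed by the $0/1$-sequences with $k$ ones and $n-k$ zeros, in a vector space over a field of characteristic zero.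
   Formalization: The formal theorem also assumes that M_1 and M_2 have ground sets of the same size; without this the claim fails, since adding a coloop to M_2 preserves all the hypotheses but changes G(M_2). *)

(* Defs.v *)
From HB Require Import structures.
From mathcomp Require Import all_boot all_order all_algebra.
From mathcomp Require Import multinomials.freeg.

Set Implicit Arguments.
Unset Strict Implicit.
Unset Printing Implicit Defensive.

Local Open Scope nat_scope.

(* The ground set of a matroid is the whole finite type [T]. *)
Record matroid (T : finType) := Matroid {
  rk : {set T} -> nat;
  rk_le_card : forall X : {set T}, rk X <= #|X|;
  rkS : forall X Y : {set T}, X \subset Y -> rk X <= rk Y;
  rk_submod : forall X Y : {set T}, rk (X :|: Y) + rk (X :&: Y) <= rk X + rk Y
}.

Section MatroidNotions.
Context (T : finType) (M : matroid T).
Implicit Types (X Y Z C D F : {set T}) (e f : T).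

Definition rank := rk M [set: T].

Definition indep X := rk M X == #|X|.

Definition circuit C := minset (fun D => ~~ indep D) C.

Definition mclosure X := [set e | rk M (e |: X) == rk M X].

Definition flat X := [forall e, (e \notin X) ==> (rk M X < rk M (e |: X))].

Definition hyperplanes := [set H | flat H && ((rk M H).+1 == rank)].

Definition paving : Prop :=
  forall H F, H \in hyperplanes -> flat F -> F \proper H -> indep F.

Definition cyclic X :=
  [exists P : {set {set T}}, [forall C in P, circuit C] && (cover P == X)].

Definition cyclic_flat X := flat X && cyclic X.

Lemma flatP X :
  reflect (forall e, rk M (e |: X) <= rk M X -> e \in X) (flat X).
Proof.
apply: (iffP forallP) => [fX e le_e|fX e].
  by apply: contraLR le_e => eX; rewrite -ltnNge; apply: (implyP (fX e)).
by apply/implyP; apply: contraR; rewrite -leqNgt; apply: fX.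
Qed.

Lemma rk_setU_le X Y :
  (forall e, e \in Y -> rk M (e |: X) <= rk M X) -> rk M (X :|: Y) <= rk M X.
Proof.
have [n] := ubnP #|Y|; elim: n Y => // n IHn Y; rewrite ltnS => leYn hY.
have [->|[e eY]] := set_0Vmem Y; first by rewrite setU0.
rewrite -(setD1K eY); set Y' := Y :\ e.
have le1 : rk M (X :|: Y') <= rk M X.
  apply: IHn => [|f]; first by rewrite (cardsD1 e) eY in leYn.
  by rewrite in_setD1 => /andP[_ /hY].
have := rk_submod M (X :|: Y') (e |: X).
have -> : X :|: Y' :|: (e |: X) = X :|: (e |: Y').
  by apply/setP=> z; rewrite !inE; do !case: (_ \in _); do ?case: (_ == _).
have le2 : rk M X <= rk M ((X :|: Y') :&: (e |: X)).
  by apply: rkS; rewrite subsetI subsetUl subsetUr.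
move=> sm; rewrite -(leq_add2r (rk M X)).
apply: leq_trans (leq_add le1 (hY e eY)).
by apply: leq_trans sm; rewrite leq_add2l.
Qed.

Lemma sub_closure X : X \subset mclosure X.
Proof. by apply/subsetP=> e eX; rewrite inE (setUidPr _) ?sub1set. Qed.

Lemma rk_closure X : rk M (mclosure X) = rk M X.
Proof.
apply/eqP; rewrite eqn_leq (rkS M (sub_closure X)) andbT.
rewrite -{1}(setUidPr (sub_closure X)); apply: rk_setU_le => e.
by rewrite inE => /eqP->.
Qed.

Lemma closure_flat X : flat (mclosure X).
Proof.
apply/flatP=> e; rewrite rk_closure => le_e; rewrite inE eqn_leq.
rewrite [X in _ && X]rkS ?subsetUr // andbT.
by apply: leq_trans le_e; apply: rkS; rewrite setUS ?sub_closure.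
Qed.

Lemma closure_sub X F : flat F -> (mclosure X \subset F) = (X \subset F).
Proof.
move/flatP=> fF; apply/idP/idP => [|XF]; first exact/subset_trans/sub_closure.
apply/subsetP=> e; rewrite inE => /eqP rk_e; apply: fF.
have := rk_submod M F (e |: X); rewrite rk_e.
have -> : F :|: (e |: X) = e |: F by rewrite setUCA (setUidPl XF).
move=> sm; rewrite -(leq_add2r (rk M X)); apply: leq_trans sm.
by rewrite leq_add2l; apply: rkS; rewrite subsetI XF subsetUr.
Qed.

Lemma flatI X Y : flat X -> flat Y -> flat (X :&: Y).
Proof.
move=> fX fY; suff <- : mclosure (X :&: Y) = X :&: Y by apply: closure_flat.
apply/eqP; rewrite eqEsubset sub_closure subsetI !closure_sub //.
by rewrite subsetIl subsetIr.
Qed.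

Lemma flatT : flat [set: T].
Proof. by apply/flatP=> e _; rewrite inE. Qed.

Lemma indepS X Y : X \subset Y -> indep Y -> indep X.
Proof.
move=> XY /eqP iY; rewrite /indep eqn_leq rk_le_card.
have eqY : X :|: Y :\: X = Y by rewrite -{1}(setIidPr XY) setID.
have := rk_submod M X (Y :\: X); rewrite eqY iY -(cardsID X Y) (setIidPr XY) => sm.
rewrite -(leq_add2r #|Y :\: X|).
apply: leq_trans (leq_addr (rk M (X :&: (Y :\: X))) _) _.
by apply: leq_trans sm _; rewrite leq_add2l rk_le_card.
Qed.

Lemma closure_circuit X e : e \in mclosure X -> e \notin X ->
  exists2 C, circuit C & (e \in C) && (C \subset e |: X).
Proof.
move=> eX nX; have i0 : indep set0 && (set0 \subset X).
  by rewrite sub0set andbT /indep eqn_leq rk_le_card cards0.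
have [I /maxsetP[/andP[iI IX] maxI] _] :=
  maxset_exists (P := fun J => indep J && (J \subset X)) i0.
have XclI : X \subset mclosure I.
  apply/subsetP=> f fX; rewrite inE eqn_leq [X in _ && X]rkS ?subsetUr // andbT.
  rewrite leqNgt; apply/negP=> lt_f.
  have nfI : f \notin I.
    by apply: contraL lt_f => fI; rewrite (setUidPr _) ?sub1set // ltnn.
  have ifI : indep (f |: I) && (f |: I \subset X).
    rewrite subUset sub1set fX IX !andbT /indep eqn_leq rk_le_card cardsU1 nfI.
    by rewrite add1n -(eqP iI).
  by move: nfI; rewrite -(maxI _ ifI (subsetUr _ _)) setU11.
have eI : e \in mclosure I.
  by move: e eX {nX}; apply/subsetP; rewrite closure_sub ?closure_flat.
have nI : e \notin I by apply: contra nX; apply: (subsetP IX).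
have dep : ~~ indep (e |: I).
  move: eI; rewrite inE /indep => /eqP->; rewrite (eqP iI) cardsU1 nI.
  by rewrite neq_ltn add1n leqnn.
have [C cC CeI] := minset_exists (P := fun D => ~~ indep D) dep.
exists C => //; rewrite (subset_trans CeI) ?setUS // andbT.
apply: contraR (minsetp cC) => nC; apply: indepS iI.
by apply/subsetP=> f fC; case/setU1P: (subsetP CeI f fC) => // ef; rewrite -ef fC in nC.
Qed.

Lemma cyclicP X : reflect
  (forall e, e \in X -> exists2 C, circuit C & (e \in C) && (C \subset X))
  (cyclic X).
Proof.
apply: (iffP existsP) => [[P /andP[/forall_inP cP /eqP<-]] e|cX].
  by case/bigcupP=> C CP eC; exists C; rewrite ?cP // eC (bigcup_sup C).
exists [set C | circuit C && (C \subset X)]; apply/andP; split.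
  by apply/forall_inP=> C; rewrite inE => /andP[].
rewrite eqEsubset; apply/andP; split.
  by apply/bigcupsP=> C; rewrite inE => /andP[].
apply/subsetP=> e /cX[C cC /andP[eC CX]]; apply/bigcupP; exists C => //.
by rewrite inE cC.
Qed.

Lemma cyclicU X Y : cyclic X -> cyclic Y -> cyclic (X :|: Y).
Proof.
move=> /cyclicP cX /cyclicP cY; apply/cyclicP=> e /setUP[/cX|/cY];
  case=> C cC /andP[eC CX]; exists C => //; rewrite eC.
  exact: subset_trans CX (subsetUl _ _).
exact: subset_trans CX (subsetUr _ _).
Qed.

Lemma closure_cyclic X : cyclic X -> cyclic (mclosure X).
Proof.
move=> /cyclicP cX; apply/cyclicP=> e eX.
have [/cX[C cC /andP[eC CX]]|nX] := boolP (e \in X).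
  by exists C => //; rewrite eC (subset_trans CX (sub_closure X)).
have [C cC /andP[eC CX]] := closure_circuit eX nX.
exists C => //; rewrite eC (subset_trans CX) // subUset sub1set eX.
exact: sub_closure.
Qed.

Definition cyclic_core X := cover [set C | circuit C && (C \subset X)].

Lemma cyclic_core_sub X : cyclic_core X \subset X.
Proof. by apply/bigcupsP=> C; rewrite inE => /andP[]. Qed.

Lemma cyclic_core_max X Y : cyclic Y -> Y \subset X -> Y \subset cyclic_core X.
Proof.
move=> /cyclicP cY YX; apply/subsetP=> e /cY[C cC /andP[eC CY]].
by apply/bigcupP; exists C; rewrite // inE cC (subset_trans CY).
Qed.

Lemma cyclic_core_cyclic_flat X : flat X -> cyclic_flat (cyclic_core X).
Proof.
move=> fX; have cX : cyclic (cyclic_core X).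
  apply/existsP; exists [set C | circuit C && (C \subset X)].
  by rewrite eqxx andbT; apply/forall_inP=> C; rewrite inE => /andP[].
rewrite /cyclic_flat cX andbT.
suff <- : mclosure (cyclic_core X) = cyclic_core X by apply: closure_flat.
apply/eqP; rewrite eqEsubset sub_closure andbT.
by apply: cyclic_core_max; rewrite ?closure_cyclic ?closure_sub ?cyclic_core_sub.
Qed.

Lemma flat_sub_hyperplane F : flat F -> rk M F < rank ->
  exists2 H, H \in hyperplanes & F \subset H.
Proof.
move=> fF ltF; have PF : flat F && (rk M F < rank) by rewrite fF.
have [H /maxsetP[/andP[fH ltH] maxH] FH] :=
  maxset_exists (P := fun H => flat H && (rk M H < rank)) PF.
exists H => //; rewrite inE fH /= eqn_leq ltH /= leqNgt; apply/negP=> lt2.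
have [/eqP HT|] := boolP (H == setT); first by rewrite HT ltnn in ltH.
rewrite -subTset => /subsetPn[e _ neH].
have le_e : rk M (e |: H) <= (rk M H).+1.
  apply: leq_trans (leq_addr (rk M ([set e] :&: H)) _) _.
  apply: leq_trans (rk_submod M _ _) _; rewrite -add1n leq_add2r.
  by rewrite -(cards1 e) rk_le_card.
have /maxH : flat (mclosure (e |: H)) && (rk M (mclosure (e |: H)) < rank).
  by rewrite closure_flat rk_closure (leq_ltn_trans le_e).
have sH : H \subset mclosure (e |: H).
  exact: subset_trans (subsetUr _ _) (sub_closure _).
move/(_ sH) => eqH; case/negP: neH; rewrite -eqH.
by apply: (subsetP (sub_closure _)); rewrite setU11.
Qed.

(* In a paving matroid of rank r, letting X range over [flats M] subject
   to #|X| < r - 1 is the same as letting X range over all sets of that size. *)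
Lemma paving_small_flat X : paving -> #|X|.+1 < rank -> flat X.
Proof.
move=> pav ltX; have ltcl : (rk M (mclosure X)).+1 < rank.
  by rewrite rk_closure (leq_ltn_trans _ ltX) // ltnS rk_le_card.
have [H hypH clH] := flat_sub_hyperplane (closure_flat X) (ltnW ltcl).
have prH : mclosure X \proper H.
  rewrite properEneq clH andbT; apply: contraTneq hypH => <-.
  by rewrite inE (ltn_eqF ltcl) andbF.
have /eqP icl := pav _ _ hypH (closure_flat X) prH.
suff -> : X = mclosure X by apply: closure_flat.
apply/eqP; rewrite eqEcard sub_closure -icl rk_closure.
exact: rk_le_card.
Qed.

End MatroidNotions.

Definition matroid_iso (T U : finType) (M : matroid T) (N : matroid U) : Prop :=
  exists2 f : T -> U, bijective f & forall X : {set T}, rk N (f @: X) = rk M X.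

Record flats (T : finType) (M : matroid T) :=
  Flat { flat_set :> {set T}; flat_setP : flat M flat_set }.

Record cyclic_flats (T : finType) (M : matroid T) :=
  CyclicFlat { cflat_set :> {set T}; cflat_setP : cyclic_flat M cflat_set }.

Fact set_order_display : Order.disp_t. Proof. exact: Order.Disp tt tt. Qed.

Section Lattices.
Context (T : finType) (M : matroid T).

HB.instance Definition _ := [isSub of flats M for @flat_set T M].
HB.instance Definition _ := [Finite of flats M by <:].
HB.instance Definition _ := [isSub of cyclic_flats M for @cflat_set T M].
HB.instance Definition _ := [Finite of cyclic_flats M by <:].

Let fle (X Y : flats M) := flat_set X \subset flat_set Y.
Fact fle_refl : reflexive fle. Proof. by move=> X; apply: subxx. Qed.
Fact fle_anti : antisymmetric fle.
Proof. by move=> X Y XY; apply/val_inj/eqP; rewrite eqEsubset. Qed.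
Fact fle_trans : transitive fle.
Proof. by move=> Y X Z; apply: subset_trans. Qed.
HB.instance Definition _ := Order.Le_isPOrder.Build set_order_display
  (flats M) fle_refl fle_anti fle_trans.

Definition fmeet (X Y : flats M) : flats M :=
  Flat (flatI (flat_setP X) (flat_setP Y)).
Definition fjoin (X Y : flats M) : flats M :=
  Flat (closure_flat M (flat_set X :|: flat_set Y)).
Fact fmeetP (X Y Z : flats M) : fle X (fmeet Y Z) = fle X Y && fle X Z.
Proof. exact: subsetI. Qed.
Fact fjoinP (X Y Z : flats M) : fle (fjoin X Y) Z = fle X Z && fle Y Z.
Proof. by rewrite /fle /= closure_sub ?subUset ?flat_setP. Qed.
HB.instance Definition _ := Order.POrder_MeetJoin_isLattice.Build
  set_order_display (flats M) fmeetP fjoinP.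

Let cle (X Y : cyclic_flats M) := cflat_set X \subset cflat_set Y.
Fact cle_refl : reflexive cle. Proof. by move=> X; apply: subxx. Qed.
Fact cle_anti : antisymmetric cle.
Proof. by move=> X Y XY; apply/val_inj/eqP; rewrite eqEsubset. Qed.
Fact cle_trans : transitive cle.
Proof. by move=> Y X Z; apply: subset_trans. Qed.
HB.instance Definition _ := Order.Le_isPOrder.Build set_order_display
  (cyclic_flats M) cle_refl cle_anti cle_trans.

Fact cmeet_subproof (X Y : cyclic_flats M) :
  cyclic_flat M (cyclic_core M (cflat_set X :&: cflat_set Y)).
Proof.
case: X Y => [X /= /andP[fX _]] [Y /= /andP[fY _]].
exact/cyclic_core_cyclic_flat/flatI.
Qed.
Fact cjoin_subproof (X Y : cyclic_flats M) :
  cyclic_flat M (mclosure M (cflat_set X :|: cflat_set Y)).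
Proof.
case: X Y => [X /= /andP[_ cX]] [Y /= /andP[_ cY]].
by rewrite /cyclic_flat closure_flat closure_cyclic ?cyclicU.
Qed.
Definition cmeet (X Y : cyclic_flats M) : cyclic_flats M :=
  CyclicFlat (cmeet_subproof X Y).
Definition cjoin (X Y : cyclic_flats M) : cyclic_flats M :=
  CyclicFlat (cjoin_subproof X Y).
Fact cmeetP (X Y Z : cyclic_flats M) : cle X (cmeet Y Z) = cle X Y && cle X Z.
Proof.
rewrite /cle /= -subsetI; apply/idP/idP => XYZ.
  exact: subset_trans XYZ (cyclic_core_sub _ _).
by apply: cyclic_core_max => //; case/andP: (cflat_setP X).
Qed.
Fact cjoinP (X Y Z : cyclic_flats M) : cle (cjoin X Y) Z = cle X Z && cle Y Z.
Proof.
by rewrite /cle /= closure_sub ?subUset //; case/andP: (cflat_setP Z).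
Qed.
HB.instance Definition _ := Order.POrder_MeetJoin_isLattice.Build
  set_order_display (cyclic_flats M) cmeetP cjoinP.

End Lattices.

Section GInvariant.
Context (K : fieldType) (T : finType) (M : matroid T).
Local Open Scope ring_scope.

Definition rank_sequence (s : seq T) : bitseq :=
  [seq (rk M [set x in take i.+1 s] - rk M [set x in take i s])%N == 1%N
     | i <- iota 0 (size s)].

(* The permutations e_1, ..., e_n of the ground set are the duplicate-free
   tuples of length n = #|T|. The formal sum lives in the vector space over K
   with basis all 0/1-sequences, in which those of length n with rank M ones
   span the usual target; equality of G-invariants is the same in both. *)
Definition G_invariant : {freeg bitseq / K} :=
  \sum_(t : #|T|.-tuple T | uniq t) << rank_sequence t >>.

End GInvariant.

(* Main.v *)
Require Import Defs.
From mathcomp Require Import all_boot all_order all_algebra.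
From mathcomp Require Import multinomials.freeg.

(* For a permutation with prefix sets X_0, ..., X_n and a bound rho, the indicator of
   "r(X_i) <= rho_i for all i" is, up to the sign (-1)^(n+1), the sum of (-1)^|c| over
   the chains c of pairs (i, Z), i an index and Z a cyclic flat with
   r(Z) + |X_i - Z| <= rho_i, in which every index occurs: r(X_i) is the minimum of
   r(Z) + |X_i - Z|, attained at the union of the circuits in the closure of X_i.
   Summing over all permutations, the contribution of a chain c depends only on the
   sizes and ranks of the cyclic flats in c, so G(M) is determined by the number of
   chains of cyclic flats with given sizes and ranks. In a paving matroid a flat is a
   hyperplane, the ground set, or any set of size less than r - 1; hence the chains
   through a hyperplane in A_j are carried by alpha_j to the chains through one in
   B_j, and all other chains are common to the two lattices of flats. *)

Set Implicit Arguments.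
Unset Strict Implicit.
Unset Printing Implicit Defensive.

Import Order.TTheory GRing.Theory.

Local Open Scope nat_scope.

(** * Sign cancellation by toggling one element *)

Section Toggle.
Context (U : finType).
Implicit Types (x y : U) (c : {set U}).

Definition toggle x c := if x \in c then c :\ x else x |: c.

Lemma in_toggle x c y :
  (y \in toggle x c) = if y == x then x \notin c else y \in c.
Proof.
rewrite /toggle; have [->|yx] := eqVneq y x; case: ifP => xc;
  by rewrite !inE ?eqxx ?(negPf yx).
Qed.

Lemma toggleK x : involutive (toggle x).
Proof.
move=> c; apply/setP=> y; rewrite !in_toggle eqxx negbK.
by have [->|] := eqVneq y x.
Qed.

Lemma sign_toggle x c : ((-1) ^+ #|toggle x c| = - (-1) ^+ #|c| :> int)%R.
Proof.
rewrite /toggle; case: ifP => xc.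
  by rewrite (cardsD1 x c) xc exprS mulN1r opprK.
by rewrite cardsU1 xc exprS mulN1r.
Qed.

(** Since the choice [x c] survives the toggle, toggling is an involution on the sets satisfying
    [ok]; it flips every sign, so the sum equals its own negative. *)
Lemma sum_toggle (ok : pred {set U}) (x : {set U} -> U) :
  (forall c, ok c -> ok (toggle (x c) c) /\ x (toggle (x c) c) = x c) ->
  (\sum_(c | ok c) (-1) ^+ #|c| = 0 :> int)%R.
Proof.
move=> okx; pose h c := toggle (x c) c.
have hK c : ok c -> h (h c) = c.
  by move=> /okx[_ ex]; rewrite /h ex toggleK.
set S := (\sum_(c | _) _)%R; suff SN : (S = - S)%R.
  by apply/eqP; rewrite -[_ == _](@Num.Theory.mulrn_eq0 _ S 2) mulr2n {2}SN subrr.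
rewrite {1}/S (reindex_onto h h) // -sumrN; apply: eq_big => c.
  apply/andP/idP => [[/okx[ok' _] /eqP eqc]|okc]; first by rewrite -eqc.
  by split; [case: (okx c okc)|rewrite hK].
by move=> _; rewrite sign_toggle.
Qed.

End Toggle.

(** * Signed sum over chains of pairs that hit every index *)

Section Chains.
Context (E : finType) (m : nat).
Implicit Types (p q x : 'I_m.+1 * {set E}) (c : {set 'I_m.+1 * {set E}}).

Definition pair_le p q := (p.1 <= q.1) && (p.2 \subset q.2).

Definition chain c :=
  [forall p in c, forall q in c, pair_le p q || pair_le q p].

Definition hits c := [forall i, exists X, (i, X) \in c].

Lemma chainP c :
  reflect {in c &, forall p q, pair_le p q || pair_le q p} (chain c).
Proof.
apply: (iffP forall_inP) => [h p q pc qc|h p pc].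
  exact: (forall_inP (h p pc)).
by apply/forall_inP=> q qc; apply: h.
Qed.

Lemma hitsP c : reflect (forall i, exists X, (i, X) \in c) (hits c).
Proof.
by apply: (iffP forallP) => h i; apply/existsP; exact: h.
Qed.

Lemma pair_le_refl p : pair_le p p.
Proof. by rewrite /pair_le leqnn subxx. Qed.

Lemma pair_le_trans : transitive pair_le.
Proof.
move=> q p x /andP[a b] /andP[a' b']; rewrite /pair_le (leq_trans a a').
exact: subset_trans b b'.
Qed.

(** The weight, index plus cardinality, strictly increases along [pair_le], so a pair of extreme
    weight in a chain is its greatest or least element. *)
Lemma pair_le_weight p q :
  pair_le p q -> q.1 + #|q.2| <= p.1 + #|p.2| -> p = q.
Proof.
case: p q => [i X] [j Y] /andP[/= ij XY] le_w.
have cXY := subset_leq_card XY.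
have eij : i = j.
  apply/val_inj/eqP; rewrite eqn_leq ij -(leq_add2r #|X|) /=.
  by apply: leq_trans le_w; rewrite leq_add2l.
congr (_, _) => //; apply/eqP; rewrite eqEcard XY.
by rewrite eij leq_add2l in le_w.
Qed.

Lemma chain_max c (S : {set 'I_m.+1 * {set E}}) : chain c -> S \subset c ->
  S != set0 -> exists2 p, p \in S & {in S, forall q, pair_le q p}.
Proof.
move=> /chainP ch Sc /set0Pn[p0 p0S].
case: (@arg_maxnP _ p0 (mem S) (fun p => p.1 + #|p.2|) p0S) => p pS maxp.
exists p => // q qS; case/orP: (ch q p (subsetP Sc q qS) (subsetP Sc p pS)) => //.
by move=> /pair_le_weight/(_ (maxp q qS))->; apply: pair_le_refl.
Qed.

Lemma chain_min c (S : {set 'I_m.+1 * {set E}}) : chain c -> S \subset c ->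
  S != set0 -> exists2 p, p \in S & {in S, forall q, pair_le p q}.
Proof.
move=> /chainP ch Sc /set0Pn[p0 p0S].
case: (@arg_minnP _ p0 (mem S) (fun p => p.1 + #|p.2|) p0S) => p pS minp.
exists p => // q qS; case/orP: (ch q p (subsetP Sc q qS) (subsetP Sc p pS)) => //.
by move=> /pair_le_weight/(_ (minp q qS))->; apply: pair_le_refl.
Qed.

Context (Q : 'I_m.+1 -> {set {set E}}).

Definition chain_in c :=
  [&& chain c, hits c & [forall p in c, p.2 \in Q p.1]].

(** Comparability of [x] with all of [c] allows it to be added; the second pair [p] at the same
    index keeps that index hit when [x] is removed. *)
Lemma chain_in_toggle x p c : chain_in c -> x.2 \in Q x.1 ->
  {in c, forall q, pair_le q x || pair_le x q} ->
  p \in c -> p.1 = x.1 -> p != x -> chain_in (toggle x c).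
Proof.
case/and3P=> /chainP ch /hitsP hc /forall_inP cQ xQ cmp pc px1 px.
apply/and3P; split.
- apply/chainP=> q s; rewrite !in_toggle.
  have [->|_] := eqVneq q x; have [->|_] := eqVneq s x.
  + by rewrite pair_le_refl.
  + by move=> _ sc; rewrite orbC cmp.
  + by move=> qc _; rewrite cmp.
  + exact: ch.
- apply/hitsP=> i; have [e|ne] := eqVneq i x.1.
    by exists p.2; rewrite e -px1 -surjective_pairing in_toggle (negPf px).
  have [X iX] := hc i; exists X; rewrite in_toggle iX.
  by case: eqP => // e; rewrite -e /= eqxx in ne.
- apply/forall_inP=> q; rewrite in_toggle; have [->//|_] := eqVneq q x.
  exact: cQ.
Qed.

(* Sign-reversing toggling: as long as some (i, X) in c has X not above Z i,
   the largest such (i, X) makes (i, J i X) comparable with all of c; otherwise,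
   the smallest (i, X) in c with X != Z i makes (i, Z i) comparable with all
   of c. Only the chain of all the (i, Z i) survives. *)
Lemma sum_chain_in (Z : 'I_m.+1 -> {set E}) (J : 'I_m.+1 -> {set E} -> {set E})
  (ZQ : forall i, Z i \in Q i)
  (Z_mono : forall i j : 'I_m.+1, i <= j -> Z i \subset Z j)
  (JQ : forall i X, X \in Q i -> J i X \in Q i)
  (J_ubl : forall i X, X \in Q i -> X \subset J i X)
  (J_ubr : forall i X, X \in Q i -> Z i \subset J i X)
  (J_lub : forall i j X Y, X \in Q i -> Y \in Q j ->
     X \subset Y -> Z i \subset Y -> J i X \subset Y) :
  (\sum_(c | chain_in c) (-1) ^+ #|c| = (-1) ^+ m.+1 :> int)%R.
Proof.
pose bad c := [set p in c | ~~ (Z p.1 \subset p.2)].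
pose off c := [set p in c | p.2 != Z p.1].
(* The default [(ord0, set0)] never matters: [xJ] is toggled only when [bad c] is nonempty and [xZ]
   only when [off c] is, and a nonempty part of a chain has a greatest and a least element. *)
pose xJ c := if [pick p in bad c | [forall q in bad c, pair_le q p]] is Some p
  then (p.1, J p.1 p.2) else (ord0, set0).
pose xZ c := if [pick p in off c | [forall q in off c, pair_le p q]] is Some p
  then (p.1, Z p.1) else (ord0, set0).
rewrite (bigID (fun c => bad c == set0)) /= addrC (sum_toggle (x := xJ)).
  rewrite add0r (bigID (fun c => off c == set0)) /= addrC.
  rewrite (sum_toggle (x := xZ)).
    rewrite add0r (big_pred1 [set (i, Z i) | i : 'I_m.+1]); last first.
      move=> c; apply/idP/eqP => [/andP[/andP[ch _] /eqP off0]|->].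
        case/and3P: ch => _ /hitsP hc _.
        have inc p : p \in c -> p = (p.1, Z p.1).
          move=> pc; move/setP/(_ p): off0; rewrite !inE pc /= => /negbFE/eqP <-.
          exact: surjective_pairing.
        apply/setP=> p; apply/idP/imsetP => [/inc ep|[i _ ->]].
          by exists p.1.
        by have [X iX] := hc i; case: (inc _ iX) => <-.
      apply/andP; split; last first.
        by apply/eqP/setP=> p; rewrite !inE; apply/andP=> -[/imsetP[i _ ->]]; rewrite eqxx.
      apply/andP; split; last first.
        by apply/eqP/setP=> p; rewrite !inE; apply/andP=> -[/imsetP[i _ ->]]; rewrite subxx.
      apply/and3P; split.
      - apply/chainP=> _ _ /imsetP[i _ ->] /imsetP[j _ ->]; rewrite /pair_le /=.
        by case/orP: (leq_total i j) => ij; rewrite ij (Z_mono _ _ ij) ?orbT.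
      - by apply/hitsP=> i; exists (Z i); apply: imset_f.
      - by apply/forall_inP=> _ /imsetP[i _ ->]; apply: ZQ.
    by rewrite card_imset ?card_ord // => i j [].
  move=> c /andP[/andP[ch /eqP bad0] off0].
  have cc : chain c by case/and3P: ch.
  have offc : off c \subset c by apply/subsetP=> p; rewrite inE => /andP[].
  have geZ p : p \in c -> Z p.1 \subset p.2.
    by move=> pc; move/setP/(_ p): bad0; rewrite !inE pc /= => /negbFE.
  have xE c' : off c' = off c -> xZ c' = xZ c by rewrite /xZ => ->.
  have [p [pc poff pmin xp]] : exists p, [/\ p \in c, p.2 != Z p.1,
      {in off c, forall q, pair_le p q} & xZ c = (p.1, Z p.1)].
    have [p poff pmin] := chain_min cc offc off0.
    rewrite /xZ; case: pickP => [p' /andP[]|/(_ p)/negP[]].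
      rewrite inE => /andP[p'c p'off] /forall_inP p'min.
      by exists p'.
    by rewrite poff; apply/forall_inP.
  (* The toggled pair [(p.1, Z p.1)] is not in [off], so [off c], and with it the choice of the
     pair, is unchanged. *)
  have offt : off (toggle (xZ c) c) = off c.
    apply/setP=> q; rewrite !inE in_toggle; case: eqP => // ->.
    by rewrite xp eqxx !andbF.
  have badt : bad (toggle (xZ c) c) = set0.
    apply/setP=> q; rewrite !inE in_toggle; case: eqP => [->|_].
      by rewrite xp subxx andbF.
    by apply/negP=> /andP[/geZ->].
  rewrite offt badt eqxx off0 !andbT; split; last exact: xE.
  rewrite xp; apply: (@chain_in_toggle _ p) => //=; last first.
    by apply: contra poff => /eqP ep; rewrite {1}ep.
  (* Pairs [(i, Z i)] are comparable with the toggled one because [Z] is monotone. Any other pair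
     [q] lies above [p], and [q.2] contains [Z q.1], hence [Z p.1]. *)
  move=> q qc; have [eq|neq] := eqVneq q.2 (Z q.1).
    rewrite /pair_le /= eq.
    by case/orP: (leq_total q.1 p.1) => ij; rewrite ij (Z_mono _ _ ij) ?orbT.
  have /pmin/andP[pq _] : q \in off c by rewrite inE qc.
  rewrite orbC {1}/pair_le /= pq /=.
  by rewrite (subset_trans (Z_mono _ _ pq) (geZ _ qc)).
move=> c /andP[ch bad0].
have cc : chain c by case/and3P: ch.
have cQ p : p \in c -> p.2 \in Q p.1.
  by case/and3P: ch => _ _ /forall_inP; apply.
have badc : bad c \subset c by apply/subsetP=> p; rewrite inE => /andP[].
have xE c' : bad c' = bad c -> xJ c' = xJ c by rewrite /xJ => ->.
have [p [pc pbad pmax xp]] : exists p, [/\ p \in c, ~~ (Z p.1 \subset p.2),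
    {in bad c, forall q, pair_le q p} & xJ c = (p.1, J p.1 p.2)].
  have [p pbad pmax] := chain_max cc badc bad0.
  rewrite /xJ; case: pickP => [p' /andP[]|/(_ p)/negP[]].
    rewrite inE => /andP[p'c p'bad] /forall_inP p'max.
    by exists p'.
  by rewrite pbad; apply/forall_inP.
have badt : bad (toggle (xJ c) c) = bad c.
  apply/setP=> q; rewrite !inE in_toggle; case: eqP => // ->.
  by rewrite xp J_ubr ?cQ ?andbF.
rewrite badt bad0 !andbT; split; last exact: xE.
rewrite xp; apply: (@chain_in_toggle _ p) => //=; first exact/JQ/cQ.
  (* Bad pairs lie below [p], hence below the toggled pair. The set of a good pair above [p]
     contains both [p.2] and [Z p.1], so also [J p.1 p.2] by [J_lub]. *)
  move=> q qc; have [qbad|qgood] := boolP (q \in bad c).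
    rewrite (pair_le_trans (pmax q qbad)) //.
    by rewrite /pair_le leqnn J_ubl ?cQ.
  have Zq : Z q.1 \subset q.2 by move: qgood; rewrite inE qc negbK.
  case/orP: (chainP _ cc q p qc pc) => [qp|/andP[pq1 pq2]].
    by rewrite (pair_le_trans qp) // /pair_le leqnn J_ubl ?cQ.
  apply/orP; right; rewrite /pair_le /= pq1 /=.
  by apply: (J_lub _ _ _ _ (cQ p pc) (cQ q qc)) => //; apply: subset_trans (Z_mono _ _ pq1) Zq.
by apply: contra pbad => /eqP ep; rewrite {2}ep /= J_ubr ?cQ.
Qed.

End Chains.

(** * Rank through the cyclic core of a closure *)

Section CyclicCore.
Context (F : finType) (M : matroid F).
Implicit Types (W X Y : {set F}).

Lemma rk_le_setD W X : rk M X <= rk M W + #|X :\: W|.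
Proof.
apply: leq_trans (leq_trans (rk_submod M W (X :\: W)) _).
  apply: leq_trans (leq_addr _ _); apply: rkS; apply/subsetP=> e eX.
  by rewrite !inE eX andbT orbN.
by rewrite leq_add2l rk_le_card.
Qed.

(** An element of [X] outside the core lies on no circuit inside [X], so it is never in the closure
    of what has been added before, and each addition raises the rank by one. *)
Lemma rk_setU_core X Y : flat M X -> Y \subset X :\: cyclic_core M X ->
  rk M (cyclic_core M X :|: Y) = rk M (cyclic_core M X) + #|Y|.
Proof.
move=> fX; set Z := cyclic_core M X.
have [n] := ubnP #|Y|; elim: n Y => // n IHn Y; rewrite ltnS => leYn YX.
have [->|[e eY]] := set_0Vmem Y; first by rewrite setU0 cards0 addn0.
have := subsetP YX e eY; rewrite inE => /andP[eZ eX].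
have YeX : Y :\ e \subset X :\: Z by apply: subset_trans YX; apply: subsetDl.
have rkYe : rk M (Z :|: Y :\ e) = rk M Z + #|Y :\ e|.
  by apply: IHn => //; rewrite (cardsD1 e) eY in leYn.
have e_new : e \notin Z :|: Y :\ e by rewrite !inE eqxx (negPf eZ).
have ZYX : Z :|: Y :\ e \subset X.
  by rewrite subUset cyclic_core_sub (subset_trans YeX) ?subsetDl.
have e_indep : e \notin mclosure M (Z :|: Y :\ e).
  apply: contra eZ => /closure_circuit/(_ e_new)[C cC /andP[eC CX]].
  apply/bigcupP; exists C => //; rewrite inE cC (subset_trans CX) //.
  by rewrite subUset sub1set eX.
have eqY : e |: (Z :|: Y :\ e) = Z :|: Y by rewrite setUCA setD1K.
apply/eqP; rewrite eqn_leq; apply/andP; split.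
  apply: leq_trans (leq_addr _ _) (leq_trans (rk_submod M Z Y) _).
  by rewrite leq_add2l rk_le_card.
rewrite (cardsD1 e Y) eY addnCA add1n -rkYe -eqY.
move: e_indep; rewrite inE => neq.
by rewrite ltn_neqAle eq_sym neq rkS ?subsetUr.
Qed.

(** An element of the closure outside [X] closes a circuit with elements of [X], so it lies in [Z].
    Thus [X] and its closure agree off [Z], where [rk_setU_core] counts one per element. *)
Lemma rk_core_closure X (Z := cyclic_core M (mclosure M X)) :
  rk M Z + #|X :\: Z| = rk M X.
Proof.
have fX := closure_flat M X.
have eqD : X :\: Z = mclosure M X :\: Z.
  apply/eqP; rewrite eqEsubset setSD ?sub_closure //=.
  apply/subsetP=> e; rewrite !inE => /andP[eZ eX]; rewrite eZ /=.
  apply: contraR eZ => neX.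
  have /closure_circuit/(_ neX)[C cC /andP[eC CX]] : e \in mclosure M X.
    by rewrite inE.
  apply/bigcupP; exists C => //; rewrite inE cC (subset_trans CX) //.
  by rewrite subUset sub1set inE eX sub_closure.
rewrite -rk_setU_core ?eqD // -[RHS]rk_closure; congr (rk M _).
by rewrite -{1}(setIidPr (cyclic_core_sub M (mclosure M X))) setID.
Qed.

(* The rank increases by at most |X :&: (Z :\: W)| since X :&: Z spans Z. *)
Lemma rk_setU_core_closure W X (Z := cyclic_core M (mclosure M X)) :
  rk M (W :|: Z) + #|X :\: (W :|: Z)| <= rk M W + #|X :\: W|.
Proof.
have span : rk M Z <= rk M (X :&: Z).
  rewrite -(leq_add2r #|X :\: Z|) rk_core_closure.
  rewrite -[X in rk M X <= _](setID X Z).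
  apply: leq_trans (leq_addr _ _) (leq_trans (rk_submod M _ _) _).
  by rewrite leq_add2l rk_le_card.
have eZ : rk M (W :|: Z) <= rk M (W :|: X :&: Z).
  have := rk_submod M (W :|: X :&: Z) Z.
  have -> : W :|: X :&: Z :|: Z = W :|: Z.
    by rewrite -setUA (setUidPr (subsetIr X Z)).
  have : rk M Z <= rk M ((W :|: X :&: Z) :&: Z).
    by apply: leq_trans span (rkS _ _); rewrite subsetI subsetUr subsetIr.
  move=> le1 le2; rewrite -(leq_add2r (rk M Z)).
  by apply: leq_trans le2; rewrite leq_add2l.
apply: leq_trans (leq_add eZ (leqnn _)) _.
have := rk_le_setD W (W :|: X :&: Z).
have -> : (W :|: X :&: Z) :\: W = (X :\: W) :&: Z.
  by apply/setP=> e; rewrite !inE; do !case: (_ \in _).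
have -> : X :\: (W :|: Z) = (X :\: W) :\: Z by rewrite setDDl.
by move=> le1; rewrite -(cardsID Z (X :\: W)) addnA leq_add2r.
Qed.

Lemma cyclic_core_closureS X Y : X \subset Y ->
  cyclic_core M (mclosure M X) \subset cyclic_core M (mclosure M Y).
Proof.
move=> XY; have /andP[_ cX] := cyclic_core_cyclic_flat (closure_flat M X).
apply: cyclic_core_max cX _; apply: subset_trans (cyclic_core_sub _ _) _.
by rewrite closure_sub ?closure_flat // (subset_trans XY) ?sub_closure.
Qed.

Lemma closure_setU_cyclic_flat W X : cyclic_flat M W -> cyclic_flat M X ->
  cyclic_flat M (mclosure M (W :|: X)).
Proof.
by move=> /andP[_ cW] /andP[_ cX]; rewrite /cyclic_flat closure_flat closure_cyclic ?cyclicU.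
Qed.

End CyclicCore.

(** * Prefix rank bounds as signed sums over chains *)

Section ChainRank.
Context (F E : finType) (M : matroid F).
Context (L : {set {set E}}) (z : {set E} -> {set F}).
Context (zS : {in L &, forall X Y, (z X \subset z Y) = (X \subset Y)}).
Context (zC : {in L, forall X, cyclic_flat M (z X)}).
Context (zE : forall Z, cyclic_flat M Z -> exists2 X, X \in L & z X = Z).

(** An instance of [sum_chain_in], pulled back along [z]: [Z i] is the cyclic core of the closure of
    [A i], and [J i X] is the join with it in the lattice of cyclic flats. *)
Lemma sum_chain_rank (m : nat) (A : 'I_m.+1 -> {set F}) (rho : 'I_m.+1 -> nat)
  (A_mono : forall i j : 'I_m.+1, i <= j -> A i \subset A j) :
  (\sum_(c | chain_in (fun i =>
        [set X in L | (rk M (z X) + #|A i :\: z X| <= rho i)%N]) c) (-1) ^+ #|c| =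
   (-1) ^+ m.+1 * [forall i, rk M (A i) <= rho i]%N%:R :> int)%R.
Proof.
case: (boolP [forall i, _]) => [/forallP le_rho|/forallPn[i lt_rho]]; last first.
  (* Every cyclic flat gives an upper bound on the rank of [A i]; where the bound [rho i] fails, no
     pair is admissible and index [i] cannot be hit. *)
  rewrite mulr0 big1 // => c /and3P[_ /hitsP/(_ i)[X iX] /forall_inP/(_ _ iX)].
  rewrite inE /= => /andP[_ le_rho]; case/negP: lt_rho.
  exact: leq_trans (rk_le_setD M (z X) (A i)) le_rho.
rewrite mulr1.
pose inv Z := odflt set0 [pick X in L | z X == Z].
have invP Z : cyclic_flat M Z -> inv Z \in L /\ z (inv Z) = Z.
  rewrite /inv => /zE[X XL zX]; case: pickP => [Y /andP[YL /eqP]//|/(_ X)].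
  by rewrite XL zX eqxx.
pose core i := cyclic_core M (mclosure M (A i)).
have coreC i : cyclic_flat M (core i) by apply/cyclic_core_cyclic_flat/closure_flat.
have joinC i X : X \in L -> cyclic_flat M (mclosure M (z X :|: core i)).
  by move=> XL; apply: closure_setU_cyclic_flat; rewrite ?zC.
apply: (@sum_chain_in _ _ _ (fun i => inv (core i))
         (fun i X => inv (mclosure M (z X :|: core i)))) => [i|i j ij|i X|i X|i X|i j X Y].
- have [iL zi] := invP _ (coreC i).
  by rewrite inE iL zi rk_core_closure le_rho.
- have [iL zi] := invP _ (coreC i); have [jL zj] := invP _ (coreC j).
  by rewrite -zS // zi zj cyclic_core_closureS ?A_mono.
- rewrite inE => /andP[XL Xrho]; have [JL zJ] := invP _ (joinC i X XL).
  (* The union with the core does not raise r(W) + |A i - W|, by [rk_setU_core_closure]; its closure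
     has the same rank and leaves out no more of [A i]. *)
  rewrite inE JL zJ rk_closure; apply: leq_trans Xrho.
  apply: leq_trans (rk_setU_core_closure M (z X) (A i)).
  by rewrite leq_add2l subset_leq_card // setDS ?sub_closure.
- rewrite inE => /andP[XL _]; have [JL zJ] := invP _ (joinC i X XL).
  by rewrite -zS // zJ (subset_trans (subsetUl _ _) (sub_closure _ _)).
- rewrite inE => /andP[XL _]; have [JL zJ] := invP _ (joinC i X XL).
  have [iL zi] := invP _ (coreC i).
  by rewrite -zS // zJ zi (subset_trans (subsetUr _ _) (sub_closure _ _)).
- rewrite !inE => /andP[XL _] /andP[YL _]; have [JL zJ] := invP _ (joinC i X XL).
  have [iL zi] := invP _ (coreC i).
  rewrite -zS // => XY; rewrite -zS // => iY; rewrite -zS // zJ closure_sub.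
    by rewrite subUset XY -zi.
  by case/andP: (zC YL).
Qed.

Definition prefix_set (n : nat) (t : n.-tuple F) (i : nat) := [set x in take i t].

Lemma prefix_setS n (t : n.-tuple F) i j :
  i <= j -> prefix_set t i \subset prefix_set t j.
Proof.
move=> ij; apply/subsetP=> x; rewrite !inE => xi.
by rewrite -(subnKC ij) takeD mem_cat xi.
Qed.

Definition chain_count n (rho : 'I_n.+1 -> nat) (c : {set 'I_n.+1 * {set E}}) :=
  #|[set t : n.-tuple F | uniq t & [forall p in c,
      rk M (z p.2) + #|prefix_set t p.1 :\: z p.2| <= rho p.1]]|.

Definition rank_count n (rho : 'I_n.+1 -> nat) :=
  #|[set t : n.-tuple F | uniq t & [forall i : 'I_n.+1, rk M (prefix_set t i) <= rho i]]|.

(** [sum_chain_rank] is applied to the prefix sets of each tuple and the sums are exchanged: the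
    admissibility condition, which depends on the tuple, moves from the chains into
    [chain_count]. *)
Lemma rank_count_chains n (rho : 'I_n.+1 -> nat) :
  ((-1) ^+ n.+1 * (rank_count rho)%:R =
   \sum_(c | chain_in (fun=> L) c) (-1) ^+ #|c| * (chain_count rho c)%:R :> int)%R.
Proof.
pose g (t : n.-tuple F) (p : 'I_n.+1 * {set E}) :=
  rk M (z p.2) + #|prefix_set t p.1 :\: z p.2| <= rho p.1.
have -> : ((rank_count rho)%:R = \sum_(t : n.-tuple F | uniq t)
    [forall i : 'I_n.+1, rk M (prefix_set t i) <= rho i]%N%:R :> int)%R.
  rewrite /rank_count -sum1_card natr_sum big_mkcond [RHS]big_mkcond /=.
  by apply: eq_bigr => t _; rewrite inE; case: (uniq t) => //=; case: ifP.
have countE c : ((chain_count rho c)%:R = \sum_(t : n.-tuple F | uniq t)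
    [forall p in c, g t p]%:R :> int)%R.
  rewrite /chain_count -sum1_card natr_sum big_mkcond [RHS]big_mkcond /=.
  by apply: eq_bigr => t _; rewrite inE; case: (uniq t) => //=; case: ifP.
under [RHS]eq_bigr => c _ do rewrite countE big_distrr /=.
rewrite exchange_big big_distrr /=; apply: eq_bigr => t _.
rewrite -(sum_chain_rank rho (fun i j : 'I_n.+1 => @prefix_setS n t i j)).
rewrite [RHS]big_mkcond [LHS]big_mkcond /=.
apply: eq_bigr => c _; rewrite /chain_in.
have -> : [forall p in c, p.2 \in [set X in L |
      rk M (z X) + #|prefix_set t p.1 :\: z X| <= rho p.1]] =
    [forall p in c, p.2 \in L] && [forall p in c, g t p].
  apply/forall_inP/andP => [h|[/forall_inP h /forall_inP h'] p pc].
    by split; apply/forall_inP=> p /h; rewrite inE => /andP[].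
  by rewrite inE h //; exact: h'.
case: (chain c) (hits c) => [] [] //=.
case: (boolP [forall p in c, _]) => _ //=.
by case: (boolP [forall p in c, _]) => _; rewrite ?mulr0 ?mulr1.
Qed.

End ChainRank.

(** * Transport of chain counts between ground sets *)

(** Elements are sorted by decreasing number of chain members containing them. An element of [z u]
    has a strictly higher level than one outside, so each [z u] comes first. *)
Lemma chain_enum (U F : finType) (z : U -> {set F}) (D : {set U}) :
  {in D &, forall u v, (z u \subset z v) || (z v \subset z u)} ->
  exists e : seq F, [/\ uniq e, e =i F &
    {in D, forall u, z u = [set x in take #|z u| e]}].
Proof.
move=> chD; pose lev x := #|[set u in D | x \in z u]|.
pose leT x y := lev y <= lev x; pose e := sort leT (enum F).
have leT_total : total leT by move=> x y; apply: leq_total.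
have leT_trans : transitive leT by move=> y x w xy yw; apply: leq_trans yw xy.
have ue : uniq e by rewrite sort_uniq enum_uniq.
have eE : e =i F by move=> x; rewrite mem_sort mem_enum.
have lev_lt u x y : u \in D -> x \in z u -> y \notin z u -> lev y < lev x.
  move=> uD xu yu; apply: proper_card; apply/properP; split; last first.
    by exists u; rewrite !inE uD ?xu ?(negPf yu).
  apply/subsetP=> v; rewrite !inE => /andP[vD yv]; rewrite vD /=.
  case/orP: (chD u v uD vD) => /subsetP; first exact.
  by move=> /(_ y yv) yu'; rewrite yu' in yu.
exists e; split=> // u uD; set k := #|z u|.
have cardT : #|[set x in take k e]| = k.
  rewrite cardsE; have /card_uniqP-> : uniq (take k e) by apply: take_uniq.
  rewrite size_takel // size_sort -cardE; exact: max_card.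
apply/eqP; rewrite eq_sym eqEcard cardT leqnn andbT; apply/subsetP=> y.
rewrite inE in_take ?eE // => yk; apply: contraT => yu.
have : ~~ (z u \subset [set x in take k e]).
  apply: contra yu => zk; suff <- : [set x in take k e] = z u.
    by rewrite inE in_take ?eE.
  by apply/eqP; rewrite eq_sym eqEcard zk cardT leqnn.
case/subsetPn=> x xu; rewrite inE in_take ?eE // -leqNgt => kx.
have := lev_lt u x y uD xu yu; rewrite ltnNge => /negP[].
have : sorted leT e by apply: sort_sorted.
move/(sorted_leq_index leT_trans (fun x => leqnn _)); rewrite -/(leT y x); apply.
- by rewrite eE.
- by rewrite eE.
- exact: ltnW (leq_trans yk kx).
Qed.

Lemma chain_bijection (U F1 F2 : finType) (D : {set U})
  (z1 : U -> {set F1}) (z2 : U -> {set F2}) : #|F1| = #|F2| ->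
  {in D &, forall u v, (z1 u \subset z1 v) || (z1 v \subset z1 u)} ->
  {in D &, forall u v, (z2 u \subset z2 v) || (z2 v \subset z2 u)} ->
  {in D, forall u, #|z1 u| = #|z2 u|} ->
  exists2 f : F1 -> F2, bijective f & {in D, forall u, f @: z1 u = z2 u}.
Proof.
move=> cardF /chain_enum[e1 [ue1 e1E ez1]] /chain_enum[e2 [ue2 e2E ez2]] eq_z.
(* Positions are matched between the two enumerations. They are always in range, so the default of
   [nth], built from the equality of cardinalities, is never returned. *)
pose f x := nth (enum_val (cast_ord cardF (enum_rank x))) e2 (index x e1).
pose g y := nth (enum_val (cast_ord (esym cardF) (enum_rank y))) e1 (index y e2).
have se : size e1 = size e2.
  by rewrite -(card_uniqP ue1) -(card_uniqP ue2) (eq_card e1E) (eq_card e2E).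
have idx1 x : index x e1 < size e2 by rewrite -se index_mem e1E.
have idx2 y : index y e2 < size e1 by rewrite se index_mem e2E.
have fK : cancel f g by move=> x; rewrite /g /f index_uniq // nth_index ?e1E.
have gK : cancel g f by move=> x; rewrite /g /f index_uniq // nth_index ?e2E.
exists f => [|u uD]; first by exists g.
apply/eqP; rewrite eqEcard (card_imset _ (can_inj fK)) eq_z ?leqnn // andbT.
apply/subsetP=> _ /imsetP[x xu ->]; rewrite ez2 // inE in_take ?e2E //.
by rewrite index_uniq //; move: xu; rewrite ez1 // inE in_take ?e1E // eq_z.
Qed.

(** The bijection from [chain_bijection] carries prefix sets to prefix sets and chain members to
    chain members, so it preserves each |X_i - Z|. *)
Lemma chain_count_transfer (E F1 F2 : finType) (M1 : matroid F1)
  (M2 : matroid F2) (z1 : {set E} -> {set F1}) (z2 : {set E} -> {set F2})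
  (n : nat) (rho : 'I_n.+1 -> nat) (c : {set 'I_n.+1 * {set E}})
  (h : {set E} -> {set E}) : #|F1| = #|F2| ->
  {in c &, forall p q, (z1 p.2 \subset z1 q.2) || (z1 q.2 \subset z1 p.2)} ->
  {in c &, forall p q,
     (z2 (h p.2) \subset z2 (h q.2)) || (z2 (h q.2) \subset z2 (h p.2))} ->
  {in c, forall p, #|z1 p.2| = #|z2 (h p.2)|} ->
  {in c, forall p, rk M1 (z1 p.2) = rk M2 (z2 (h p.2))} ->
  chain_count M2 z2 rho [set (p.1, h p.2) | p in c] = chain_count M1 z1 rho c.
Proof.
move=> cardF ch1 ch2 eq_z eq_rk.
have [f bij_f fz] := chain_bijection cardF ch1 ch2 eq_z.
have inj_f := bij_inj bij_f; have [g fK gK] := bij_f.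
pose fT (t : n.-tuple F1) : n.-tuple F2 := map_tuple f t.
have bij_fT : bijective fT.
  exists (fun t => map_tuple g t) => t; apply/val_inj; rewrite /= -map_comp.
    by rewrite (eq_map (g := id)) ?map_id.
  by rewrite (eq_map (g := id)) ?map_id.
rewrite /chain_count -(on_card_preimset (f := fT)); last exact: onW_bij.
apply: eq_card => t; rewrite !inE map_inj_uniq //; congr (_ && _).
have cE p : p \in c ->
    (rk M2 (z2 (h p.2)) + #|prefix_set (fT t) p.1 :\: z2 (h p.2)| <= rho p.1) =
    (rk M1 (z1 p.2) + #|prefix_set t p.1 :\: z1 p.2| <= rho p.1).
  move=> pc; rewrite -eq_rk // -fz //.
  have -> : prefix_set (fT t) p.1 = f @: prefix_set t p.1.
    apply/setP=> y; rewrite -[y]gK (mem_imset _ _ inj_f) !inE /= -map_take.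
    by rewrite mem_map.
  have -> : f @: prefix_set t p.1 :\: f @: z1 p.2 = f @: (prefix_set t p.1 :\: z1 p.2).
    by apply/setP=> y; rewrite -[y]gK in_setD !(mem_imset _ _ inj_f) in_setD.
  by rewrite card_imset.
apply/forall_inP/forall_inP => [H p pc|H _ /imsetP[p pc ->]].
  by rewrite -cE //; apply: (H (p.1, h p.2)); apply: imset_f.
by rewrite /= cE ?H.
Qed.

(** * From cumulative counts to the G-invariant *)

(** Inversion of cumulative counts by induction on the sum of the values of [rho]: every other
    profile below [rho] has a smaller sum, so those fibres already agree and cancel. *)
Lemma card_fibre_cumulative (T1 T2 I : finType) (k : nat)
  (S1 : {set T1}) (S2 : {set T2})
  (D1 : T1 -> {ffun I -> 'I_k}) (D2 : T2 -> {ffun I -> 'I_k}) :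
  (forall rho : {ffun I -> 'I_k},
     #|[set t in S1 | [forall i, D1 t i <= rho i]]| =
     #|[set t in S2 | [forall i, D2 t i <= rho i]]|) ->
  forall rho, #|[set t in S1 | D1 t == rho]| = #|[set t in S2 | D2 t == rho]|.
Proof.
move=> eq_cum rho; have [N] := ubnP (\sum_i rho i).
elim: N rho => // N IHN rho; rewrite ltnS => le_rho.
have cumE (T : finType) (S : {set T}) (D : T -> {ffun I -> 'I_k}) :
    #|[set t in S | [forall i, D t i <= rho i]]| =
    #|[set t in S | D t == rho]| +
    \sum_(s : {ffun I -> 'I_k} | [forall i, s i <= rho i] && (s != rho))
      #|[set t in S | D t == s]|.
  rewrite -sum1_card (partition_big D (fun s => [forall i, s i <= rho i])) /=.
    rewrite (bigD1 rho) /=; last by apply/forallP.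
    congr (_ + _); last apply: eq_bigr => s /andP[s_le _];
      rewrite -sum1_card; apply: eq_bigl => t; rewrite !inE.
      case: eqP => [->|]; rewrite ?andbF // !andbT.
      by case: (t \in S) => //=; apply/forallP.
    by case: eqP => [->|]; rewrite ?andbF // !andbT s_le andbT.
  by move=> t; rewrite inE => /andP[].
have := eq_cum rho; rewrite !cumE.
rewrite (eq_bigr (fun s => #|[set t in S2 | D2 t == s]|)).
  by move=> /eqP; rewrite eqn_add2r => /eqP.
move=> s /andP[/forallP s_le s_neq]; apply: IHN; apply: leq_trans le_rho.
have [i s_lt] : exists i, s i < rho i.
  apply/existsP; apply: contraR s_neq => /existsPn ge_s.
  apply/eqP/ffunP=> i; apply/val_inj/eqP.
  by rewrite eqn_leq s_le leqNgt ge_s.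
rewrite (bigD1 i) //= [X in _ < X](bigD1 i) //= -addSn.
by apply: leq_add => //; apply: leq_sum => j _.
Qed.

Lemma sum_rank_sequence (K : fieldType) (F1 F2 : finType) (M1 : matroid F1)
  (M2 : matroid F2) (n : nat) :
  (forall rho : 'I_n.+1 -> nat, rank_count M1 rho = rank_count M2 rho) ->
  (\sum_(t : n.-tuple F1 | uniq t) << rank_sequence M1 t >> =
   \sum_(t : n.-tuple F2 | uniq t) << rank_sequence M2 t >>
     :> {freeg bitseq / K})%R.
Proof.
move=> eq_count.
pose S (F : finType) := [set t : n.-tuple F | uniq t].
(* The profile of all prefix ranks; these are at most [n], so [inord] keeps their values. *)
pose D (F : finType) (M : matroid F) (t : n.-tuple F) : {ffun 'I_n.+1 -> 'I_n.+1} :=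
  [ffun i : 'I_n.+1 => inord (rk M (prefix_set t i))].
have DE F (M : matroid F) t (i : 'I_n.+1) : D F M t i = rk M (prefix_set t i) :> nat.
  rewrite ffunE inordK // ltnS; apply: leq_trans (rk_le_card _ _) _.
  rewrite cardsE; apply: leq_trans (card_size _) _.
  by rewrite size_take size_tuple; case: ltnP => // /ltnW.
(* The rank sequence is a function of the profile, so the tuples can be grouped by profile. *)
pose w (d : {ffun 'I_n.+1 -> 'I_n.+1}) : bitseq :=
  [seq (d (inord i.+1) - d (inord i))%N == 1%N | i <- iota 0 n].
have sumE F (M : matroid F) :
    (\sum_(t : n.-tuple F | uniq t) << rank_sequence M t >> =
     \sum_(d : {ffun 'I_n.+1 -> 'I_n.+1})
       << w d >> *+ #|[set t in S F | D F M t == d]| :> {freeg bitseq / K})%R.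
  rewrite (partition_big (D F M) predT) //=; apply: eq_bigr => d _.
  rewrite -sumr_const; apply: eq_big => [t|t /andP[_ /eqP <-]]; first by rewrite !inE.
  congr (<< _ >>)%R; rewrite /rank_sequence /w size_tuple.
  apply/eq_in_map => i; rewrite mem_iota /= add0n => lt_in.
  by rewrite !DE !inordK // ltnW.
rewrite !sumE; apply: eq_bigr => d _; congr (_ *+ _)%R.
apply: card_fibre_cumulative => rho.
have countE F (M : matroid F) : #|[set t in S F | [forall i, D F M t i <= rho i]]| =
    rank_count M (fun i => rho i : nat).
  apply: eq_card => t; rewrite !inE; congr (_ && _).
  by apply: eq_forallb => i; rewrite DE.
by rewrite !countE.
Qed.

(** * Lattice isomorphisms as maps on subsets *)

Section FlatImage.
Context (E F : finType) (N : matroid E) (M : matroid F).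
Context (phi : {lmorphism flats N -> cyclic_flats M}).

(** Extended to all subsets, with the empty set as value off the flats, so that the chains for both
    paving matroids consist of plain subsets of [E]. *)
Definition flat_image (X : {set E}) : {set F} :=
  oapp (fun x : flats N => cflat_set (phi x)) set0 (insub X).

Lemma flat_imageE (X : flats N) : flat_image X = phi X.
Proof. by rewrite /flat_image (valK X). Qed.

Lemma flat_image_cyclic :
  {in [set X | flat N X], forall X, cyclic_flat M (flat_image X)}.
Proof.
move=> X; rewrite inE => fX.
by rewrite (flat_imageE (Flat fX)); apply: cflat_setP.
Qed.

(** Inclusion says that the meet of X and Y is X, an equation that a meet morphism preserves and an
    injective one reflects. *)
Lemma flat_image_subset : bijective phi ->
  {in [set X | flat N X] &, forall X Y,
    (flat_image X \subset flat_image Y) = (X \subset Y)}.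
Proof.
move=> /bij_inj inj_phi X Y; rewrite !inE => fX fY.
rewrite (flat_imageE (Flat fX)) (flat_imageE (Flat fY)).
rewrite -[LHS]/(phi (Flat fX) <= phi (Flat fY))%O -[RHS]/(Flat fX <= Flat fY)%O.
by rewrite !leEmeet -omorphI inj_eq.
Qed.

Lemma flat_image_onto : bijective phi -> forall Z, cyclic_flat M Z ->
  exists2 X, X \in [set X | flat N X] & flat_image X = Z.
Proof.
move=> [psi _ psiK] Z cZ; exists (flat_set (psi (CyclicFlat cZ))).
  by rewrite inE; apply: flat_setP.
by rewrite flat_imageE psiK.
Qed.

End FlatImage.

(** * Flats of a paving matroid *)

Section PavingFlats.
Context (E : finType) (N : matroid E).
Implicit Types (X Y H : {set E}).

Lemma flat_rk_eq X Y : flat N X -> X \subset Y -> rk N Y <= rk N X -> X = Y.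
Proof.
move=> /flatP fX XY le_rk; apply/eqP; rewrite eqEsubset XY.
apply/subsetP=> e eY; apply: fX; apply: leq_trans le_rk; apply: rkS.
by rewrite subUset sub1set eY.
Qed.

Lemma hyperplane_card H : H \in hyperplanes N -> rank N - 1 <= #|H|.
Proof. by rewrite inE => /andP[_ /eqP<-]; rewrite subn1 rk_le_card. Qed.

Lemma hyperplane_neqT H : H \in hyperplanes N -> H != setT.
Proof.
rewrite inE => /andP[_ /eqP eH]; apply: contra_eq_neq eH => ->.
by rewrite gtn_eqF.
Qed.

Lemma hyperplane_eq X Y : X \in hyperplanes N -> Y \in hyperplanes N ->
  (X \subset Y) || (Y \subset X) -> X = Y.
Proof.
rewrite !inE => /andP[fX /eqP eX] /andP[fY /eqP]; rewrite -eX => -[eY].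
by case/orP=> [XY|YX]; [|apply: esym]; apply: flat_rk_eq; rewrite // eY.
Qed.

(** A flat other than the ground set lies in a hyperplane. If properly, it is independent, so its
    size is its rank: either r - 1, and it is a hyperplane, or less. *)
Lemma paving_flatE X : paving N ->
  flat N X = [|| X \in hyperplanes N, #|X| < rank N - 1 | X == setT].
Proof.
move=> pav; apply/idP/or3P => [fX|[|small|/eqP->]]; last exact: flatT.
- have : rk N X <= rank N by apply: rkS; apply: subsetT.
  rewrite leq_eqVlt => /orP[/eqP eX|ltX].
    by constructor 3; apply/eqP/(flat_rk_eq fX (subsetT X)); rewrite eX.
  have [H hypH XH] := flat_sub_hyperplane fX ltX.
  have [->|neXH] := eqVneq X H; first by constructor 1.
  have /eqP iX : indep N X by apply: (pav _ _ hypH fX); rewrite properEneq neXH.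
  move: (ltX); rewrite leq_eqVlt => /orP[eX|lt1X].
    by constructor 1; rewrite inE fX.
  by constructor 2; rewrite -iX ltn_subRL.
- by rewrite inE => /andP[].
- by apply: paving_small_flat => //; move: small; rewrite ltn_subRL.
Qed.

(** Only [H] itself is a hyperplane comparable with [H], so flatness is decided by [H] and by size.
    This form is carried over by [alpha j], which need not respect hyperplanes outside [A j]. *)
Lemma paving_flat_comparableE X H : paving N -> H \in hyperplanes N ->
  (X \subset H) || (H \subset X) ->
  flat N X = [|| X == H, #|X| < rank N - 1 | X == setT].
Proof.
move=> pav hypH cmp; rewrite paving_flatE //; congr (_ || _).
by apply/idP/eqP => [hypX|->//]; apply: hyperplane_eq.
Qed.

End PavingFlats.

(** * Splitting and relabelling chain sums *)

Section ChainSums.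
Context (E : finType) (m : nat).
Implicit Types (c : {set 'I_m.+1 * {set E}}) (L D : {set {set E}}).
Local Notation chain_of L := (@chain_in E m (fun=> L)).

Lemma chain_comparable c : chain c ->
  {in c &, forall p q : 'I_m.+1 * {set E}, (p.2 \subset q.2) || (q.2 \subset p.2)}.
Proof.
by move=> /chainP ch p q pc qc; case/orP: (ch p q pc qc) => /andP[_ ->]; rewrite ?orbT.
Qed.

Definition touches D c := [exists p in c, p.2 \in D].

(** [D] is an antichain, so a chain contains at most one member of [D], perhaps at several indices,
    and touches exactly one block [A j] once it touches [D]. *)
Lemma sum_chains_split (p : nat) L D (A : 'I_p -> {set {set E}})
  (T : {set 'I_m.+1 * {set E}} -> int) :
  (forall X, reflect (exists j, X \in A j) (X \in D)) ->
  (forall j k X, X \in A j -> X \in A k -> j = k) ->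
  (forall X Y, X \in D -> Y \in D -> (X \subset Y) || (Y \subset X) -> X = Y) ->
  (\sum_(c | chain_of L c) T c =
   \sum_(c | chain_of L c && ~~ touches D c) T c +
   \sum_j \sum_(c | chain_of L c && touches (A j) c) T c)%R.
Proof.
move=> memD disjA antiD; rewrite (bigID (touches D)) /= addrC; congr (_ + _)%R.
rewrite (exchange_big_dep (fun c => chain_of L c && touches D c)) /=.
  apply: eq_bigr => c /andP[chc /exists_inP[q qc /memD[j qj]]].
  rewrite (big_pred1 j) // => k; rewrite chc /=; apply/exists_inP/eqP => [[s sc sk]|->].
    apply: (disjA k j q.2) => //.
    have <- // : s.2 = q.2; apply: antiD.
    - by apply/memD; exists k.
    - by apply/memD; exists j.
    - by apply: chain_comparable sc qc; case/and3P: chc.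
  by exists q.
move=> j c _ /andP[-> /exists_inP[q qc qj]]; apply/exists_inP; exists q => //.
by apply/memD; exists j.
Qed.

Definition chain_map (a : E -> E) c := [set (p.1, a @: p.2) | p : 'I_m.+1 * {set E} in c].

Context (a : E -> E) (a_inj : injective a).

Lemma chain_map_elem_inj :
  injective (fun p : 'I_m.+1 * {set E} => (p.1, a @: p.2)).
Proof. by move=> [i X] [j Y] [-> /(imset_inj a_inj)->]. Qed.

Lemma mem_chain_map c i (X : {set E}) : ((i, a @: X) \in chain_map a c) = ((i, X) \in c).
Proof. exact: (mem_imset _ (i, X) chain_map_elem_inj). Qed.

Lemma chain_map_inj : injective (chain_map a).
Proof. exact/imset_inj/chain_map_elem_inj. Qed.

Lemma card_chain_map c : #|chain_map a c| = #|c|.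
Proof. exact: card_imset chain_map_elem_inj. Qed.

Lemma subset_imset_inj (X Y : {set E}) : (a @: X \subset a @: Y) = (X \subset Y).
Proof.
apply/idP/idP => [/subsetP XY|]; last exact: imsetS.
by apply/subsetP=> x xX; rewrite -(mem_imset _ _ a_inj) XY ?imset_f.
Qed.

Lemma chain_chain_map c : chain (chain_map a c) = chain c.
Proof.
apply/chainP/chainP => ch => [p q pc qc|_ _ /imsetP[p pc ->] /imsetP[q qc ->]].
  have := ch _ _ (imset_f _ pc) (imset_f _ qc).
  by rewrite /pair_le /= !subset_imset_inj.
by rewrite /pair_le /= !subset_imset_inj; apply: ch.
Qed.

Lemma hits_chain_map c : hits (chain_map a c) = hits c.
Proof.
apply/hitsP/hitsP => hc i; have [X iX] := hc i.
  by case/imsetP: iX => -[j Y] jY [-> _]; exists Y.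
by exists (a @: X); rewrite mem_chain_map.
Qed.

Lemma touches_chain_map D D' c : (forall X : {set E}, (a @: X \in D') = (X \in D)) ->
  touches D' (chain_map a c) = touches D c.
Proof.
move=> DD'; apply/exists_inP/exists_inP => -[].
  by move=> _ /imsetP[p pc ->] /=; rewrite DD' => pD; exists p.
move=> p pc pD; exists (p.1, a @: p.2); first exact: imset_f.
by rewrite DD'.
Qed.

Lemma all_chain_map L c : [forall p in chain_map a c, p.2 \in L] =
  [forall p : 'I_m.+1 * {set E} in c, a @: p.2 \in L].
Proof.
apply/forall_inP/forall_inP => h => [p pc|_ /imsetP[p pc ->]]; last exact: h.
by apply: (h (p.1, a @: p.2)); apply: imset_f.
Qed.

End ChainSums.

Lemma imset_eqT (E : finType) (a : E -> E) (X : {set E}) :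
  injective a -> (a @: X == setT) = (X == setT).
Proof. by move=> a_inj; rewrite !eqEcard !subsetT /= card_imset. Qed.

(** * Comparison of the two chain sums *)

Lemma sum_chains_transfer (E F1 F2 : finType) (N1 N2 : matroid E)
  (M1 : matroid F1) (M2 : matroid F2) (cardF : #|F1| = #|F2|)
  (r p : nat) (rankN1 : rank N1 = r) (rankN2 : rank N2 = r)
  (pavingN1 : paving N1) (pavingN2 : paving N2)
  (A B : 'I_p -> {set {set E}}) (alpha : 'I_p -> E -> E)
  (alpha_inj : forall j, injective (alpha j))
  (alphaAB : forall j (X : {set E}), (alpha j @: X \in B j) = (X \in A j))
  (memA : forall X, reflect (exists j, X \in A j)
                            (X \in hyperplanes N1 :\: hyperplanes N2))
  (memB : forall X, reflect (exists j, X \in B j)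
                            (X \in hyperplanes N2 :\: hyperplanes N1))
  (disjA : forall j k X, X \in A j -> X \in A k -> j = k)
  (disjB : forall j k X, X \in B j -> X \in B k -> j = k)
  (z1 : {set E} -> {set F1}) (z2 : {set E} -> {set F2})
  (z1S : {in [set X | flat N1 X] &,
            forall X Y, (z1 X \subset z1 Y) = (X \subset Y)})
  (z2S : {in [set X | flat N2 X] &,
            forall X Y, (z2 X \subset z2 Y) = (X \subset Y)})
  (z_common : forall X, flat N1 X -> flat N2 X ->
     #|z1 X| = #|z2 X| /\ rk M1 (z1 X) = rk M2 (z2 X))
  (z_hyp : forall j Y, Y \in A j ->
     #|z1 Y| = #|z2 (alpha j @: Y)| /\ rk M1 (z1 Y) = rk M2 (z2 (alpha j @: Y)))
  (z_small : forall j (X Y : {set E}), Y \in A j -> X \subset Y -> #|X| < r - 1 ->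
     #|z1 X| = #|z1 (alpha j @: X)| /\ rk M1 (z1 X) = rk M1 (z1 (alpha j @: X)))
  (n : nat) (rho : 'I_n.+1 -> nat) :
  (\sum_(c | chain_in (fun=> [set X | flat N1 X]) c)
     (-1) ^+ #|c| * (chain_count M1 z1 rho c)%:R =
   \sum_(c | chain_in (fun=> [set X | flat N2 X]) c)
     (-1) ^+ #|c| * (chain_count M2 z2 rho c)%:R :> int)%R.
Proof.
have AH j Y : Y \in A j -> Y \in hyperplanes N1.
  by move=> YA; have /memA : exists j, Y \in A j; [exists j | rewrite inE => /andP[]].
have BH j Y : Y \in B j -> Y \in hyperplanes N2.
  by move=> YB; have /memB : exists j, Y \in B j; [exists j | rewrite inE => /andP[]].
(* A hyperplane is never a flat of another kind in [paving_flatE]; hence a hyperplane of only one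
   matroid is not a flat of the other. *)
have H1_small X : X \in hyperplanes N1 -> (#|X| < r - 1) || (X == setT) = false.
  move=> hX; rewrite (negPf (hyperplane_neqT hX)) orbF.
  by apply/negbTE; rewrite -leqNgt -rankN1 hyperplane_card.
have H2_small X : X \in hyperplanes N2 -> (#|X| < r - 1) || (X == setT) = false.
  move=> hX; rewrite (negPf (hyperplane_neqT hX)) orbF.
  by apply/negbTE; rewrite -leqNgt -rankN2 hyperplane_card.
rewrite (sum_chains_split _ _ memA disjA); last first.
  by move=> X Y /setDP[hX _] /setDP[hY _]; apply: (hyperplane_eq hX hY).
rewrite (sum_chains_split _ _ memB disjB); last first.
  by move=> X Y /setDP[hX _] /setDP[hY _]; apply: (hyperplane_eq hX hY).
congr (_ + _)%R; last apply: eq_bigr => j _.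
(* Apart from the hyperplanes belonging to one matroid only, [N1] and [N2] have the same flats, so
   the chains avoiding those hyperplanes coincide. *)
- have stable X : (X \in [set X | flat N1 X]) && (X \notin hyperplanes N1 :\: hyperplanes N2) =
      (X \in [set X | flat N2 X]) && (X \notin hyperplanes N2 :\: hyperplanes N1).
    rewrite !in_setD (in_set (flat N1)) (in_set (flat N2)) !paving_flatE // rankN1 rankN2.
    move: (H1_small X) (H2_small X); case: (X \in hyperplanes N1) => [/(_ isT)->|_].
      by case: (X \in hyperplanes N2).
    by case: (X \in hyperplanes N2) => [/(_ isT)->|_].
  have predE L D (c : {set 'I_n.+1 * {set E}}) :
      chain_in (fun=> L) c && ~~ touches D c =
      [&& chain c, hits c & [forall q in c, (q.2 \in L) && (q.2 \notin D)]].
    rewrite /chain_in -!andbA; do 2 congr (_ && _).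
    apply/andP/forall_inP => [[/forall_inP cL cD] q qc|h].
      by rewrite cL //=; apply: contra cD => qD; apply/exists_inP; exists q.
    split; first by apply/forall_inP=> q /h/andP[].
    by apply/exists_inP=> -[q /h/andP[_ /negPf->]].
  apply: eq_big => c.
    rewrite !predE; do 2 congr (_ && _).
    by apply: eq_forallb => q; rewrite stable.
  rewrite predE => /and3P[ch _ /forall_inP h].
  have f1 q : q \in c -> flat N1 q.2 by move=> /h; rewrite inE => /andP[].
  have f2 q : q \in c -> flat N2 q.2 by move=> /h; rewrite stable inE => /andP[].
  congr (_ * _%:R)%R.
  have idc : [set (q.1, id q.2) | q : 'I_n.+1 * {set E} in c] = c.
    by rewrite -[RHS]imset_id; apply: eq_imset => -[].
  rewrite -(@chain_count_transfer E F1 F2 M1 M2 z1 z2 n rho c id) ?idc //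
    => [q s qc sc|q s qc sc|q qc|q qc].
  + by rewrite !z1S ?inE ?f1 // (chain_comparable ch).
  + by rewrite /= !z2S ?inE ?f2 // (chain_comparable ch).
  + by case: (z_common _ (f1 q qc) (f2 q qc)).
  + by case: (z_common _ (f1 q qc) (f2 q qc)).
rewrite [RHS](reindex_inj (chain_map_inj (alpha_inj j))) /=.
(* Along a chain through a hyperplane [s.2] in [A j], [alpha j] sends flats of [N1] to flats of [N2]
   and non-flats to non-flats. *)
have flatE (c : {set 'I_n.+1 * {set E}}) q s : chain c -> q \in c -> s \in c ->
    s.2 \in A j -> (flat N1 q.2 = [|| q.2 == s.2, #|q.2| < r - 1 | q.2 == setT]) /\
      (flat N2 (alpha j @: q.2) = flat N1 q.2).
  move=> ch qc sc sA; have cmp := chain_comparable ch qc sc.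
  have e1 := paving_flat_comparableE pavingN1 (AH _ _ sA) cmp.
  have /BH hB : alpha j @: s.2 \in B j by rewrite alphaAB.
  rewrite (paving_flat_comparableE pavingN2 hB) ?subset_imset_inj //.
  rewrite e1 rankN1 rankN2 (inj_eq (imset_inj (alpha_inj j))) imset_eqT //.
  by rewrite card_imset.
apply: eq_big => c.
  rewrite /chain_in chain_chain_map // hits_chain_map // all_chain_map.
  rewrite (touches_chain_map (D := A j)) //.
  case: (boolP (chain c)) => //= ch.
  case: (boolP (hits c)) => //= _.
  case: (boolP (touches (A j) c)) => [/exists_inP[s sc sA]|_]; rewrite ?andbF ?andbT //.
  apply: eq_forallb => q; case: (boolP (q \in c)) => //= qc.
  by rewrite !inE; case: (flatE c q s ch qc sc sA).
move=> /andP[/and3P[ch _ /forall_inP cL] /exists_inP[s sc sA]].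
rewrite card_chain_map //; congr (_ * _%:R)%R; symmetry.
have f1 q : q \in c -> flat N1 q.2 by move=> /cL; rewrite inE.
have f2 q : q \in c -> flat N2 (alpha j @: q.2).
  by move=> qc; case: (flatE c q s ch qc sc sA) => _ ->; apply: f1.
have eq_data q : q \in c -> #|z1 q.2| = #|z2 (alpha j @: q.2)| /\
    rk M1 (z1 q.2) = rk M2 (z2 (alpha j @: q.2)).
  move=> qc; have [e1 _] := flatE c q s ch qc sc sA.
  have := f1 q qc; rewrite e1 => /or3P[/eqP->|small|/eqP eT].
  - exact: z_hyp.
  - have qs : q.2 \subset s.2.
      case/orP: (chain_comparable ch qc sc) => // /subset_leq_card sq.
      have := hyperplane_card (AH _ _ sA).
      by rewrite rankN1 leqNgt (leq_ltn_trans sq small).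
    (* [z_small] passes from [q.2] to its image while staying with [z1]; the image is small too,
       hence a flat of both matroids, and [z_common] then passes to [z2]. *)
    have [-> ->] := z_small j q.2 s.2 sA qs small.
    apply: z_common; last exact: f2.
    by rewrite paving_flatE // rankN1 card_imset // small orbT.
  - have aT : alpha j @: q.2 = q.2 by apply/eqP; rewrite eT imset_eqT.
    by have := f2 q qc; rewrite aT; apply: z_common; apply: f1.
apply: (@chain_count_transfer E F1 F2 M1 M2 z1 z2 n rho c (fun X => alpha j @: X))
  => // [q t qc tc|q t qc tc|q /eq_data[]//|q /eq_data[]//].
  by rewrite !z1S ?inE ?f1 // (chain_comparable ch).
by rewrite !z2S ?inE ?f2 // !subset_imset_inj // (chain_comparable ch).
Qed.

(** * Indexed partitions and the conclusion *)

Lemma partition_indexP (T I : finType) (A : I -> {set T}) (D : {set T}) :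
  partition [set A j | j : I] D ->
  forall x, reflect (exists j, x \in A j) (x \in D).
Proof.
move=> /cover_partition <- x; apply: (iffP bigcupP) => [[_ /imsetP[j _ ->]]|[j xj]].
  by exists j.
by exists (A j); rewrite ?imset_f.
Qed.

Lemma partition_index_inj (T I : finType) (A : I -> {set T}) (D : {set T}) :
  injective A -> partition [set A j | j : I] D ->
  forall j k x, x \in A j -> x \in A k -> j = k.
Proof.
move=> A_inj /and3P[_ trivA _] j k x xj xk; apply: A_inj.
by rewrite -(def_pblock trivA _ xj) ?imset_f // (def_pblock trivA _ xk) ?imset_f.
Qed.

Theorem theorem5p1
  (K : fieldType) (charK : [pchar K]%R =i pred0)
  (E F1 F2 : finType) (r p : nat)
  (N1 N2 : matroid E)
  (rankN1 : rank N1 = r) (rankN2 : rank N2 = r)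
  (pavingN1 : paving N1) (pavingN2 : paving N2)
  (noniso : ~ matroid_iso N1 N2)
  (A B : 'I_p -> {set {set E}})
  (A_inj : injective A) (B_inj : injective B)
  (A_part : partition [set A j | j : 'I_p] (hyperplanes N1 :\: hyperplanes N2))
  (B_part : partition [set B j | j : 'I_p] (hyperplanes N2 :\: hyperplanes N1))
  (alpha : 'I_p -> E -> E) (alpha_bij : forall j, bijective (alpha j))
  (alphaAB : forall j (X : {set E}), X \in A j <-> alpha j @: X \in B j)
  (M1 : matroid F1) (M2 : matroid F2) (cardM : #|F1| = #|F2|)
  (phi1 : {lmorphism flats N1 -> cyclic_flats M1})
  (phi2 : {lmorphism flats N2 -> cyclic_flats M2})
  (phi1_bij : bijective phi1) (phi2_bij : bijective phi2)
  (phi_common : forall (X1 : flats N1) (X2 : flats N2),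
     X1 = X2 :> {set E} ->
     #|phi1 X1| = #|phi2 X2| /\ rk M1 (phi1 X1) = rk M2 (phi2 X2))
  (phi_hyp : forall (j : 'I_p) (Y1 : flats N1) (Y2 : flats N2),
     (Y1 : {set E}) \in A j -> Y2 = alpha j @: Y1 :> {set E} ->
     #|phi1 Y1| = #|phi2 Y2| /\ rk M1 (phi1 Y1) = rk M2 (phi2 Y2))
  (phi_small : forall (j : 'I_p) (Y X X' : flats N1),
     (Y : {set E}) \in A j -> X \subset Y -> #|X| < r - 1 ->
     X' = alpha j @: X :> {set E} ->
     #|phi1 X| = #|phi1 X'| /\ rk M1 (phi1 X) = rk M1 (phi1 X')) :
  G_invariant K M1 = G_invariant K M2.
Proof.
have alpha_inj j : injective (alpha j) by apply: bij_inj.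
have memA := partition_indexP A_part; have memB := partition_indexP B_part.
have flatA j Y : Y \in A j -> flat N1 Y.
  move=> YA; have /memA : exists j, Y \in A j by exists j.
  by rewrite !inE => /andP[_ /andP[]].
have flatB j Y : Y \in B j -> flat N2 Y.
  move=> YB; have /memB : exists j, Y \in B j by exists j.
  by rewrite !inE => /andP[_ /andP[]].
(* Small sets and their images under [alpha j] are flats of [N1], so [flat_image] agrees with [phi1]
   on them and [phi_small] applies. *)
have flat_small (X : {set E}) : #|X| < r - 1 -> flat N1 X.
  by move=> small; rewrite paving_flatE // rankN1 small orbT.
rewrite /G_invariant -cardM; apply: sum_rank_sequence => rho.
(* The counts are compared in [int], where the sign in [rank_count_chains] can be cancelled. *)
suff : ((rank_count M1 rho)%:R = (rank_count M2 rho)%:R :> int)%R.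
  by move/eqP; rewrite Num.Theory.eqr_nat => /eqP.
apply: (@mulfI int ((-1) ^+ #|F1|.+1)%R); first by rewrite signr_eq0.
rewrite (rank_count_chains (flat_image_subset phi1_bij)
  (flat_image_cyclic phi1) (flat_image_onto phi1_bij)).
rewrite (rank_count_chains (flat_image_subset phi2_bij)
  (flat_image_cyclic phi2) (flat_image_onto phi2_bij)).
apply: (sum_chains_transfer cardM rankN1 rankN2 pavingN1 pavingN2 alpha_inj _
  memA memB (partition_index_inj A_inj A_part) (partition_index_inj B_inj B_part)
  (flat_image_subset phi1_bij) (flat_image_subset phi2_bij)).
- by move=> j X; apply/idP/idP => /alphaAB.
- move=> X f1 f2; rewrite (flat_imageE phi1 (Flat f1)) (flat_imageE phi2 (Flat f2)).
  exact: phi_common.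
- move=> j Y YA; have f1 := flatA _ _ YA.
  have f2 : flat N2 (alpha j @: Y) by apply/flatB/alphaAB/YA.
  rewrite (flat_imageE phi1 (Flat f1)) (flat_imageE phi2 (Flat f2)).
  exact: (@phi_hyp j).
- move=> j X Y YA XY small; have fX := flat_small _ small.
  have faX : flat N1 (alpha j @: X) by apply: flat_small; rewrite card_imset.
  rewrite (flat_imageE phi1 (Flat fX)) (flat_imageE phi1 (Flat faX)).
  exact: (@phi_small j (Flat (flatA _ _ YA))).
Qed.
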